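(* Let $\mathcal M,\mathcal N$ be von Neumann algebras, $\mathcal N$ acting on a Hilbert space $\mathcal H$, let $f\in\mathrm{OC}(0,+\infty)$, and let $\widetilde f(t)=tf(t^{-1})$, $t>0$, be the transpose of $f$ (which again belongs to $\mathrm{OC}(0,+\infty)$). Let $\Phi,\Psi\in\mathrm{CP}(\mathcal M,\mathcal N)$. Then $$\widehat S_{\widetilde f}(\Phi\|\Psi)=\widehat S_f(\Psi\|\Phi).$$
   Context: Conventions. $\mathrm{CP}(\mathcal M,\mathcal N)$ is the set of all completely positive linear maps $\mathcal M\to\mathcal N$ (not assumed normal). $\mathcal N_*^+$ is the positive cone of the predual. Inner products are linear in the first variable. $\mathrm{OC}(0,+\infty)$ is the set of real-valued operator convex functions on $(0,+\infty)$. We put $0\cdot(+\infty)=0$. Extended lower-semibounded part. For a von Neumann algebra $\mathcal N$, $\widehat{\mathcal N}_{\mathrm{lb}}$ is the set of maps $m:\mathcal N_*^+\to(-\infty,+\infty]$ that are positively homogeneous ($m(\lambda\varphi)=\lambda m(\varphi)$, $\lambda\ge0$), additive, norm lower semicontinuous, and satisfy $m(\varphi)\ge\ell\varphi(1)$ for some $\ell\in\mathbb R$ and all $\varphi$. Order and operations are pointwise. For $C\in\mathbb B(\mathcal H,\mathcal K)$ and $m\in\widehat{\mathbb B(\mathcal K)}_{\mathrm{lb}}$, $C^*mC\in\widehat{\mathbb B(\mathcal H)}_{\mathrm{lb}}$ is $(C^*mC)(\omega)=m(C\omega C^* )$ with $(C\omega C^* )(X)=\omega(C^*XC)$. If $\mathcal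 N$ acts on $\mathcal H$, then $m\in\widehat{\mathcal N}_{\mathrm{lb}}$ is identified with $\omega\mapsto m(\omega|_{\mathcal N})$ in $\widehat{\mathbb B(\mathcal H)}_{\mathrm{lb}}$; this identifies $\widehat{\mathcal N}_{\mathrm{lb}}$ with the elements $m$ of $\widehat{\mathbb B(\mathcal H)}_{\mathrm{lb}}$ affiliated with $\mathcal N$ (i.e. $u'^*mu'=m$ for all unitaries $u'\in\mathcal N'$). Perspective. For $f\in\mathrm{OC}(0,+\infty)$ let $f(+0)=\lim_{t\downarrow0}f(t)$, $f'(+\infty)=\lim_{t\to+\infty}f(t)/t$, and define $\phi_f:[0,\infty)^2\to(-\infty,+\infty]$ by $\phi_f(s,t)=tf(s/t)$ for $s,t>0$, $\phi_f(s,0)=f'(+\infty)s$, $\phi_f(0,t)=f(+0)t$. If $A,B\in\mathbb B(\mathcal K)_+$ with $A+B=I$ and $A=\int_{[0,1]}t\,dE(t)$, then $\phi_f(A,B)\in\widehat{\mathbb B(\mathcal K)}_{\mathrm{lb}}$ is $\phi_f(A,B)(\omega)=\int_{[0,1]}\phi_f(t,1-t)\,d\omega(E(t))$. Divergence. A minimal Stinespring representation $(\pi,V,\mathcal K)$ of $\Gamma\in\mathrm{CP}(\mathcal M,\mathcal N)$ consists of a unital $*$-representation $\pi$ of $\mathcal M$ on $\mathcal K$ and $V\in\mathbb B(\mathcal H,\mathcal K)$ with $\Gamma(x)=V^*\pi(x)V$ and $\overline{\operatorname{span}}\,\pi(\mathcal M)V\mathcal H=\mathcal K$. For $\Phi,\Psi\in\mathrm{CP}(\mathcal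 M,\mathcal N)$, let $(\pi,V,\mathcal K)$ be a minimal Stinespring representation of $\Phi+\Psi$ and $A',B'\in\pi(\mathcal M)'$ the unique positive contractions with $\Phi(x)=V^*A'\pi(x)V$, $\Psi(x)=V^*B'\pi(x)V$ (so $A'+B'=I$). The maximal $f$-divergence is $\widehat S_f(\Phi\|\Psi)=V^*\phi_f(A',B')V$, which is an element of $\widehat{\mathcal N}_{\mathrm{lb}}\subseteq\widehat{\mathbb B(\mathcal H)}_{\mathrm{lb}}$, independent of the choices. *)

(* Defs.v *)
From mathcomp Require Import all_boot all_order all_algebra.
From mathcomp Require Import sesquilinear spectral.
From mathcomp Require Import complex.
From mathcomp Require Import all_classical all_reals all_analysis.

Set Implicit Arguments.
Unset Strict Implicit.
Unset Printing Implicit Defensive.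

Import Order.TTheory GRing.Theory Num.Theory.
Import numFieldNormedType.Exports.

Local Open Scope classical_set_scope.
Local Open Scope ring_scope.
Local Open Scope complex_scope.

Section OperatorConvex.
Variable R : realType.
Implicit Types (f : R -> R) (n : nat).

(* f(A) for a Hermitian matrix A, whose spectrum is real. *)
Definition mxfun f n (A : 'M[R[i]]_n) : 'M[R[i]]_n :=
  invmx (spectralmx A)
    *m diag_mx (map_mx (fun z => (f (complex.Re z))%:C) (spectral_diag A))
    *m spectralmx A.

Definition posdefmx n (A : 'M[R[i]]_n) : Prop :=
  A \is hermsymmx /\ forall v : 'rV[R[i]]_n, v != 0 -> 0 < dotmx (v *m A) v.

Definition loewner_le n (A B : 'M[R[i]]_n) : Prop :=
  forall v : 'rV[R[i]]_n, 0 <= dotmx (v *m (B - A)) v.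

(* OC(0,+oo); the values of f outside ]0,+oo[ are irrelevant. *)
Definition operator_convex f : Prop :=
  forall n (A B : 'M[R[i]]_n) (l : R), posdefmx A -> posdefmx B ->
    0 <= l <= 1 ->
    loewner_le (mxfun f (l%:C *: A + (1 - l)%:C *: B))
               (l%:C *: mxfun f A + (1 - l)%:C *: mxfun f B).

Definition transpose f : R -> R := fun t => t * f t^-1.

(* phi_f on [0,+oo[^2. *)
Definition perspective f (s t : R) : \bar R :=
  if t == 0 then (lim ((f u / u)%:E @[u --> +oo%R]) * s%:E)%E
  else if s == 0 then (lim ((f u)%:E @[u --> 0^'+]) * t%:E)%E
  else (t * f (s / t))%:E.

End OperatorConvex.

Record hilbert (R : realType) := Hilbert {
  hilbert_space :> completeNormedModType R[i] ;
  hdot : {dot hilbert_space for Num.conj} ;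
  hdot_norm : forall x : hilbert_space, `|x| ^+ 2 = hdot x x }.

Notation "''[' x , y ]" := (hdot _ x y) : ring_scope.

Section Operators.
Variable R : realType.
Implicit Types L H K : hilbert R.

Definition bounded_op H K : set (H -> K) :=
  [set T | linear T /\ continuous T].

(* The adjoint, characterized by <T x, y> = <x, T^* y>; it exists for bounded T
   by the Riesz representation theorem. *)
Definition adj H K (T : H -> K) : K -> H :=
  xget (fun=> 0) [set S | bounded_op S /\ forall x y, '[T x, y] = '[x, S y]].

Definition pos_op H (T : H -> H) : Prop := forall h, 0 <= '[T h, h].

Definition contractive_op H (T : H -> H) : Prop := forall h, `|T h| <= `|h|.

Definition projection H (P : H -> H) : Prop :=
  [/\ bounded_op P, P \o P = P & forall x y, '[P x, y] = '[x, P y]].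

Definition lin_span H (S : set H) : set H :=
  [set v | exists (n : nat) (c : 'I_n -> R[i]) (s : 'I_n -> H),
     (forall i, S (s i)) /\ v = \sum_i c i *: s i].

Definition commutant H (M : set (H -> H)) : set (H -> H) :=
  [set T | bounded_op T /\ forall x, M x -> T \o x = x \o T].

(* M'' is always a unital subalgebra, so the last two clauses also make M one. *)
Definition von_neumann_algebra H (M : set (H -> H)) : Prop :=
  [/\ M `<=` @bounded_op H H,
      forall x, M x -> M (adj x) &
      commutant (commutant M) = M].

Definition linear_on H (V : lmodType R[i]) (M : set (H -> H))
    (F : (H -> H) -> V) : Prop :=
  forall (a : R[i]) x y, M x -> M y -> F (a *: x + y) = a *: F x + F y.

(* Positivity of the operator matrix (a i j) acting on the direct sum H^n. *)
Definition pos_opmx H n (a : 'I_n -> 'I_n -> (H -> H)) : Prop :=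
  forall h : 'I_n -> H, 0 <= \sum_i \sum_j '[a i j (h j), h i].

(* CP(M,N); a map M -> N is given by a function whose values outside M are
   irrelevant. *)
Definition completely_positive H K (M : set (H -> H)) (N : set (K -> K))
    (G : (H -> H) -> (K -> K)) : Prop :=
  [/\ forall x, M x -> N (G x),
      linear_on M G &
      forall n (a : 'I_n -> 'I_n -> (H -> H)), (forall i j, M (a i j)) ->
        pos_opmx a -> pos_opmx (fun i j => G (a i j))].

Definition star_rep H K (M : set (H -> H)) (p : (H -> H) -> (K -> K)) : Prop :=
  [/\ forall x, M x -> bounded_op (p x),
      linear_on M p,
      forall x y, M x -> M y -> p (x \o y) = p x \o p y,
      forall x, M x -> p (adj x) = adj (p x) &
      p id = id].

Definition minimal_stinespring L H K (M : set (L -> L))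
    (G : (L -> L) -> (H -> H)) (p : (L -> L) -> (K -> K)) (V : H -> K) : Prop :=
  [/\ star_rep M p,
      bounded_op V,
      forall x, M x -> G x = adj V \o p x \o V &
      closure (lin_span [set k | exists x h, M x /\ k = p x (V h)]) = setT].

End Operators.

Section Predual.
Variable R : realType.
Implicit Types L H K : hilbert R.

Definition square_summable H (xi : nat -> H) : Prop :=
  cvgn (series (fun k => `|xi k| ^+ 2)).

(* Continuity on N for the sigma-weak topology, which is generated by the
   seminorms X |-> |\sum_k <X xi_k, eta_k>| with xi, eta square-summable. *)
Definition sigma_weakly_continuous H (N : set (H -> H))
    (w : (H -> H) -> R[i]) : Prop :=
  exists (n : nat) (xi eta : 'I_n -> nat -> H) (c : R[i]),
    (forall i, square_summable (xi i) /\ square_summable (eta i)) /\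
    forall X, N X ->
      `|w X| <= c * \sum_i `|limn (series (fun k => '[X (xi i k), eta i k]))|.

(* A functional on N is encoded by its extension by 0 outside N, so that patch (fun=> 0) N w
   is the restriction of w to N. *)
Definition predual_pos H (N : set (H -> H)) : set ((H -> H) -> R[i]) :=
  [set w | [/\ w = patch (fun=> 0) N w,
               linear_on N (w : (H -> H) -> R[i]^o),
               forall X, N X -> pos_op X -> 0 <= w X &
               sigma_weakly_continuous N w]].

Definition functional_norm H (N : set (H -> H)) (w : (H -> H) -> R[i]) : R :=
  sup [set complex.Re `|w X| | X in [set X | N X /\ contractive_op X]].

(* Elements are extended by 0 outside the cone predual_pos N. *)
Definition lb_part H (N : set (H -> H)) : set (((H -> H) -> R[i]) -> \bar R) :=
  [set m | [/\ m = patch (fun=> 0%E) (predual_pos N) m /\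
               (forall w, predual_pos N w -> m w <> -oo%E),
      forall (l : R) w, 0 <= l -> predual_pos N w ->
        m (l%:C \*o w) = (l%:E * m w)%E,
      forall v w, predual_pos N v -> predual_pos N w ->
        m (v \+ w) = (m v + m w)%E,
      forall w (a : R), predual_pos N w -> (a%:E < m w)%E ->
        exists2 d : R, 0 < d & forall v, predual_pos N v ->
          functional_norm N (v \- w) < d -> (a%:E < m v)%E &
      exists l : R, forall w, predual_pos N w ->
        ((l * complex.Re (w id))%:E <= m w)%E]].

(* C w C^* *)
Definition conj_functional H K (C : H -> K) (w : (H -> H) -> R[i]) :
    (K -> K) -> R[i] :=
  patch (fun=> 0) (@bounded_op R K K) (fun X => w (adj C \o X \o C)).

(* C^* m C *)
Definition conj_lb H K (C : H -> K) (m : ((K -> K) -> R[i]) -> \bar R) :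
    ((H -> H) -> R[i]) -> \bar R :=
  fun w => m (conj_functional C w).

(* The set function S |-> w(E(S)); it is a measure when w is positive and
   sigma-weakly continuous and E is a spectral measure. *)
Definition functional_measure K (E : set R -> (K -> K)) (w : (K -> K) -> R[i]) :
    set R -> \bar R :=
  fun S => (complex.Re (w (E S)))%:E.

(* E is a projection-valued measure on the Borel sets of [0,1] and
   A = \int_[0,1] t dE(t). *)
Definition spectral_measure K (E : set R -> (K -> K)) (A : K -> K) : Prop :=
  [/\ forall S, measurable S -> projection (E S),
      E `[0, 1]%classic = id,
      forall F : nat -> set R, (forall i, measurable (F i)) ->
        trivIset setT F -> forall h,
        series (fun i => E (F i) h) @ \oo --> E (\bigcup_i F i) h &
      forall h, (complex.Re '[A h, h])%:E =
        (\int[functional_measure E (fun X => '[X h, h]%R)]_(t in `[0%R, 1%R]) t%:E)%E].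

Definition op_perspective f K (E : set R -> (K -> K)) :
    ((K -> K) -> R[i]) -> \bar R :=
  fun w => (\int[functional_measure E w]_(t in `[0%R, 1%R])
    perspective f t (1 - t)%R)%E.

(* m is the element of the lower-semibounded part of N which is identified with
   V^* phi_f(A', B') V. *)
Definition is_max_divergence L H (M : set (L -> L)) (N : set (H -> H))
    (f : R -> R) (Phi Psi : (L -> L) -> (H -> H))
    (m : ((H -> H) -> R[i]) -> \bar R) : Prop :=
  lb_part N m /\
  exists (K : hilbert R) (p : (L -> L) -> (K -> K)) (V : H -> K)
         (A B : K -> K) (E : set R -> (K -> K)),
  [/\ minimal_stinespring M (Phi \+ Psi) p V,
      [/\ commutant (p @` M) A, pos_op A, contractive_op A &
          forall x, M x -> Phi x = adj V \o A \o p x \o V],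
      [/\ commutant (p @` M) B, pos_op B, contractive_op B &
          forall x, M x -> Psi x = adj V \o B \o p x \o V],
      A + B = id /\ spectral_measure E A &
      forall w, predual_pos (@bounded_op R H H) w ->
        m (patch (fun=> 0) N w) =
          conj_lb V (op_perspective f E) w].

(* The element satisfying is_max_divergence exists, by Stinespring's theorem and
   the spectral theorem, and does not depend on K, p, V, A, B and E. *)
Definition max_divergence L H (M : set (L -> L)) (N : set (H -> H))
    (f : R -> R) (Phi Psi : (L -> L) -> (H -> H)) :
    ((H -> H) -> R[i]) -> \bar R :=
  xget (fun=> 0%E) [set m | is_max_divergence M N f Phi Psi m].

End Predual.

(* Main.v *)
From HB Require Import structures.
Require Import Defs.
From mathcomp Require Import all_boot all_order all_algebra.
From mathcomp Require Import sesquilinear spectral.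
From mathcomp Require Import complex ring.
From mathcomp Require Import all_classical all_reals all_analysis.
From mathcomp Require Import measurable_realfun.
Set Implicit Arguments.
Unset Strict Implicit.
Unset Printing Implicit Defensive.
Import Order.TTheory GRing.Theory Num.Theory.
Import numFieldNormedType.Exports.
Local Open Scope classical_set_scope.
Local Open Scope ring_scope.

(** Two independent facts make up the theorem.

    The equality of divergences is the symmetry of the perspective. One has
    phi_{f~}(s, t) = phi_f(t, s) ([perspective_transpose]): for s, t > 0 this is
    algebra, and on the axes it says that f~(u) / u and f(1 / u) have the
    same behaviour as u tends to +oo. A datum (pi, V, K, A', B', E) that computes
    the divergence of (Phi, Psi) becomes one for (Psi, Phi) by exchanging A' and
    B' = I - A' and pushing the spectral measure E of A' forward along
    t |-> 1 - t, which gives that of B' ([spectral_measure_mirror]). Since (pi, V)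
    is a minimal Stinespring representation of Phi + Psi = Psi + Phi, nothing else
    changes, and the change of variables t |-> 1 - t turns one integral of the
    perspective into the other ([is_max_divergence_swap]). So the two divergences
    have the same defining property.

    Operator convexity of f~ is Jensen's operator inequality in disguise. For
    T = l A + (1 - l) B the matrices C_1 = l^(1/2) T^(-1/2) A^(1/2) and
    C_2 = (1 - l)^(1/2) T^(-1/2) B^(1/2) satisfy C_1 C_1^* + C_2 C_2^* = I and
    C_1 A^-1 C_1^* + C_2 B^-1 C_2^* = T^-1. Jensen's inequality
    f(T^-1) <= C_1 f(A^-1) C_1^* + C_2 f(B^-1) C_2^*, conjugated by T^(1/2), is the
    convexity inequality for f~, because A^(1/2) f(A^-1) A^(1/2) = f~(A)
    ([posdef_sqrt]). Jensen's inequality itself comes from the compression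
    inequality ([spectral_fun_compression]) once (C_1, C_2) is completed to a
    unitary ([matrix_convex_transpose]). *)

(** * The perspective of the transpose *)

Section Perspective.
Variable R : realType.
Implicit Types (f : R -> R) (s t : R).

(** Inversion carries the filter at +oo to the filter of right neighbourhoods of
    0; this is what exchanges f'(+oo) and f(+0). *)
Lemma near_pinfty_inv (P : set R) :
  (\forall u \near +oo%R, P u^-1) <-> (\forall u \near 0^'+, P u).
Proof.
split.
- move=> [a [_ aP]]; pose b := Num.max a 1.
  have b0 : 0 < b by rewrite lt_max ltr01 orbT.
  near=> u; rewrite -[u]invrK; apply: aP.
  have u0 : 0 < u by near: u; exact: nbhs_right_gt.
  apply: (@le_lt_trans _ _ b); first by rewrite le_max lexx.
  rewrite -[b]invrK ltf_pV2 ?posrE ?invr_gt0//.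
  by near: u; apply: nbhs_right_lt; rewrite invr_gt0.
- move=> -[e /= e0 eP].
  near=> u; have u0 : 0 < u by near: u; apply: nbhs_pinfty_gt; rewrite ?num_real.
  apply: eP; rewrite ?invr_gt0//= sub0r normrN gtr0_norm ?invr_gt0//.
  rewrite -[e]invrK ltf_pV2 ?posrE ?invr_gt0//.
  by near: u; apply: nbhs_pinfty_gt; rewrite ?num_real.
Unshelve. all: by end_near. Qed.

Lemma lim_inv_pinfty (g h : R -> \bar R) :
  (forall u : R, 0 < u -> g u = h u^-1) ->
  lim (g u @[u --> +oo%R]) = lim (h u @[u --> 0^'+]).
Proof.
move=> gh; congr (lim _); apply/funext => P; apply: propext.
transitivity (\forall u \near +oo%R, P (h u^-1)); last first.
  exact: (near_pinfty_inv (fun u => P (h u))).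
change ((\forall u \near +oo%R, P (g u)) <-> \forall u \near +oo%R, P (h u^-1)).
split=> gP; near=> u.
- rewrite -gh; last by near: u; apply: nbhs_pinfty_gt; rewrite ?num_real.
  by near: u; exact: gP.
- have /gh gu : 0 < u by near: u; apply: nbhs_pinfty_gt; rewrite ?num_real.
  by rewrite gu; near: u; exact: gP.
Unshelve. all: by end_near. Qed.

(** On each axis the limit of f~(u) / u or f~(u) on the left becomes that of f(u)
    or f(u) / u on the right; at the origin both limits are multiplied by 0. *)
Lemma perspective_transpose f s t :
  perspective (transpose f) s t = perspective f t s.
Proof.
rewrite /perspective /transpose.
have [s0|s0] := eqVneq s 0; have [t0|t0] := eqVneq t 0; rewrite ?s0 ?t0.
- by rewrite !mule0.
- rewrite -(@lim_inv_pinfty (fun u => (f u / u)%:E)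
    (fun u => (u * f u^-1)%:E)) // => u u0.
  by rewrite invrK mulrC.
- rewrite (@lim_inv_pinfty _ (fun u => (f u)%:E)) // => u u0.
  by rewrite mulrAC divff ?mul1r // gt_eqF.
- by rewrite invf_div mulrA [t * _]mulrC divfK.
Qed.
End Perspective.

(** * Integrals against set functions *)

Section ChangeOfVariables.
Context d (T : measurableType d) (R : realType) (s : T -> T).
Hypotheses (ms : measurable_fun setT s) (ss : involutive s).
Implicit Types mu nu : set T -> \bar R.
Import HBNNSimple.

Lemma nnsfun_comp (h : {nnsfun T >-> R}) :
  exists h' : {nnsfun T >-> R}, forall x, h' x = h (s x).
Proof.
have mhs : measurable_fun setT (h \o s) by exact: measurableT_comp.
have fhs : finite_set (range (h \o s)).
  apply: sub_finite_set (fimfunP h) => _ [x _ <-].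
  by exists (s x).
have nhs x : 0 <= (h \o s) x by exact: fun_ge0.
pose m1 := isMeasurableFun.Build _ _ T R (h \o s) mhs.
pose m2 := FiniteImage.Build T R (h \o s) fhs.
pose m3 := isNonNegFun.Build T R (h \o s) nhs.
pose h' : {nnsfun T >-> R} := HB.pack (h \o s) m1 m2 m3.
by exists h'.
Qed.

(** Reparametrizing simple functions by [s] is enough for the change of variables:
    a simple integral only sees the values of the set function on the level sets,
    which are measurable. *)
Lemma sup_sintegral_le mu nu (g : T -> \bar R) :
  (forall S, measurable S -> nu S = mu (s @^-1` S)) ->
  (ereal_sup [set sintegral nu h |
    h in [set h : {nnsfun T >-> R} | forall x, (h x)%:E <= g x]] <=
  ereal_sup [set sintegral mu h |
    h in [set h : {nnsfun T >-> R} | forall x, (h x)%:E <= g (s x)]])%E.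
Proof.
move=> numu; apply: ereal_sup_le => _ [h hg <-].
have [h' h'E] := nnsfun_comp h.
exists h'; first by move=> x; rewrite h'E; exact: hg.
rewrite /sintegral; apply: eq_fsbigr => r _.
by rewrite numu//; congr (_ * mu _)%E; apply/seteqP; split => x /=; rewrite h'E.
Qed.

(** Stated for an arbitrary set function, since that is what occurs when a
    functional is evaluated along a spectral measure. *)
Lemma eq_integral_setfun mu (D : set T) (f g : T -> \bar R) :
  {in D, f =1 g} -> integral mu D f = integral mu D g.
Proof. by rewrite /integral => /eq_restrictP ->. Qed.

(** Agreement on measurable sets suffices, so that with [s] the identity this
    replaces a set function by a measure that agrees with it there. *)
Lemma integral_involutive mu nu (D : set T) (f : T -> \bar R) :
  (forall S, measurable S -> nu S = mu (s @^-1` S)) ->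
  (integral nu D f = integral mu (s @^-1` D) (f \o s))%E.
Proof.
move=> numu.
have munu S : measurable S -> mu S = nu (s @^-1` S).
  move=> mS; rewrite numu; last by rewrite -[X in measurable X]setTI; exact: ms.
  by congr mu; apply/seteqP; split => x /=; rewrite ss.
have restrictE x : ((f \o s) \_ (s @^-1` D)) x = (f \_ D) (s x).
  by rewrite /patch; congr (if _ then _ else _); apply/idP/idP; rewrite !inE.
have key g g' : (forall x, g' x = g (s x)) ->
  ereal_sup [set sintegral nu h |
    h in [set h : {nnsfun T >-> R} | forall x, (h x)%:E <= g x]]%E =
  ereal_sup [set sintegral mu h |
    h in [set h : {nnsfun T >-> R} | forall x, (h x)%:E <= g' x]]%E.
  move=> g'E; have -> : g' = g \o s by exact/funext.
  apply/eqP; rewrite eq_le sup_sintegral_le//=.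
  apply: (le_trans (sup_sintegral_le (g \o s) munu)).
  apply: ereal_sup_le => _ [h hg <-].
  by exists h => // x; move: (hg x); rewrite /= ss.
by rewrite /integral; congr (_ - _)%E; apply: key => x;
  rewrite ?funeposE ?funenegE restrictE.
Qed.
End ChangeOfVariables.

(** * The reflected spectral measure *)

Section Spectral.
Variable R : realType.
Local Open Scope complex_scope.

Lemma ReD : {morph (@complex.Re R) : z z' / z + z'}.
Proof. by move=> [? ?] [? ?]. Qed.

(** Polarization writes the real part of the inner product in terms of norms,
    so its continuity follows from that of the norm. *)
Lemma Re_hdotE (K : hilbert R) (x h : K) : (complex.Re '[x, h])%:C =
  2^-1 * (`|x + h| ^+ 2 - `|x| ^+ 2 - `|h| ^+ 2).
Proof.
rewrite !hdot_norm hnormD expr0 mul1r ReJ_add mulrC; congr (_ * _).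
by ring.
Qed.

Lemma cvg_Re_hdot (K : hilbert R) (u : nat -> K) (x h : K) : u @ \oo --> x ->
  (fun n => complex.Re '[u n, h]) @ \oo --> complex.Re '[x, h].
Proof.
move=> ux.
pose C : numFieldType := R[i].
have cvgC : (fun n => (complex.Re '[u n, h])%:C : C) @ \oo -->
    ((complex.Re '[x, h])%:C : C).
  under eq_fun do rewrite Re_hdotE.
  rewrite Re_hdotE; apply: cvgM; first exact: cvg_cst.
  apply: cvgB; last exact: cvg_cst.
  apply: cvgB; rewrite ?expr2; apply: cvgM; apply: cvg_norm => //;
    by apply: cvgD => //; exact: cvg_cst.
apply/cvgrPdist_lt => e e0.
move/cvgrPdist_lt: cvgC => /(_ e%:C).
rewrite ltcR => /(_ e0); apply: filterS => n.
rewrite -rmorphB/= normc_def/= expr0n addr0 sqrtr_sqr ltcR.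
by [].
Qed.

Section SpectralMeasure.
Variables (K : hilbert R) (E : set R -> K -> K) (A : K -> K).
Hypothesis EA : spectral_measure E A.

(** Countable additivity for the constant family of empty sets makes the series
    with constant term E(set0) h converge, so that term is 0. *)
Lemma spectral_set0 h : E set0 h = 0.
Proof.
case: EA => _ _ Eadd _.
have := Eadd (fun=> set0) (fun=> measurable0) (@trivIset_set0 _ _ _) h.
rewrite bigcup0// => Ecvg.
have /cvg_lim <- // := cvg_series_cvg_0 (cvgP _ Ecvg).
by apply/esym/cvg_lim => //; exact: cvg_cst.
Qed.

(** Since E(S) is a projection, the state is the squared norm of E(S) h. *)
Lemma vector_state_ge0 S h : measurable S -> 0 <= complex.Re '[E S h, h].
Proof.
move=> mS; case: EA => /(_ _ mS)[_ idem sa] _ _ _.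
rewrite -[E S]idem /= sa -hdot_norm.
have : 0 <= `|E S h| ^+ 2 by rewrite exprn_ge0.
by rewrite lecE => /andP[].
Qed.

(** Nothing is known about E outside the measurable sets, so the set function is
    replaced by 0 there in order to obtain a measure. *)
Lemma vector_state_measure h : exists mu : {measure set R -> \bar R},
  forall S, measurable S -> mu S = functional_measure E (fun X => '[X h, h]) S.
Proof.
pose mu (S : set R) : \bar R :=
  if `[< measurable S >] then functional_measure E (fun X => '[X h, h]) S else 0%E.
have muE S : measurable S -> mu S = (complex.Re '[E S h, h])%:E.
  by move=> mS; rewrite /mu; case: asboolP.
have mu0 : mu set0 = 0%E by rewrite muE// spectral_set0 linear0l.
have mu_ge0 S : (0 <= mu S)%E.
  rewrite /mu; case: asboolP => // mS.
  by rewrite lee_fin vector_state_ge0.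
have mu_sigma : semi_sigma_additive mu.
  move=> F mF tF mUF; rewrite muE//.
  case: EA => _ _ /(_ F mF tF h) Ecvg _.
  have -> : (fun n => (\sum_(0 <= i < n) mu (F i))%E) =
      EFin \o (fun n => complex.Re '[series (fun i => E (F i) h) n, h]).
    apply/funext => n /=; under eq_bigr do rewrite muE//.
    rewrite sumEFin linear_sumlz; congr EFin; apply/esym.
    by apply: (big_morph (@complex.Re R)) => //; exact: ReD.
  by apply: cvg_EFin; [exact: nearW|exact: cvg_Re_hdot].
pose m := isMeasure.Build _ _ _ mu mu0 mu_ge0 mu_sigma.
pose mu' : {measure set R -> \bar R} := HB.pack mu m.
by exists mu'.
Qed.

(** The reflection of the spectral parameter that carries A to I - A. *)
Definition mirror (S : set R) : set R := (fun t => 1 - t) @^-1` S.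

Lemma measurable_sub1 : measurable_fun setT (fun t : R => 1 - t).
Proof. exact: measurable_funB. Qed.

Lemma sub1K : involutive (fun t : R => 1 - t).
Proof. by move=> t; rewrite opprB addrC subrK. Qed.

Lemma mirror_itv01 : mirror `[0, 1]%classic = `[0, 1]%classic.
Proof.
apply/seteqP; split => t; rewrite /mirror /= !in_itv/= subr_ge0 gerBl => /andP[-> ->] //.
Qed.

Lemma integral_mirror (w : (K -> K) -> R[i]) (f : R -> \bar R) :
  (\int[functional_measure (E \o mirror) w]_(t in `[0%R, 1%R]) f t =
   \int[functional_measure E w]_(t in `[0%R, 1%R]) f (1 - t)%R)%E.
Proof.
rewrite -[X in (_ = integral _ X _)%E]mirror_itv01.
by apply: (integral_involutive measurable_sub1 sub1K).
Qed.

(** The two integrals add up to the total mass, because t + (1 - t) = 1 and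
    E([0, 1]) = I. *)
Lemma integral_vector_state_compl h :
  (\int[functional_measure E (fun X => '[X h, h]%R)]_(t in `[0%R, 1%R]) t%:E +
   \int[functional_measure E (fun X => '[X h, h]%R)]_(t in `[0%R, 1%R]) (1 - t)%:E
   = (complex.Re '[h, h])%:E)%E.
Proof.
have [mu muE] := vector_state_measure h.
have intE (f : R -> \bar R) :
    (\int[functional_measure E (fun X => '[X h, h]%R)]_(t in `[0%R, 1%R]) f t =
     \int[mu]_(t in `[0%R, 1%R]) f t)%E.
  apply/esym; apply: (@integral_involutive _ _ _ id) => //.
have m01 : measurable (`[0%R, 1%R]%classic : set R) by exact: measurable_itv.
rewrite !intE -ge0_integralD//=.
- under eq_integral do rewrite -EFinD addrC subrK.
  rewrite integral_cst//= mul1e muE//= /functional_measure.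
  by case: EA => _ -> _ _.
- by move=> t; rewrite in_itv/= => /andP[].
- by move=> t; rewrite in_itv/= lee_fin subr_ge0 => /andP[].
- apply/measurable_EFinP; exact: measurable_funTS measurable_sub1.
Qed.

(** The first moment of the reflected measure is the total mass minus the first
    moment of the original one, that is <h, h> - <A h, h> = <B h, h>. *)
Lemma spectral_measure_mirror (B : K -> K) : A + B = id ->
  spectral_measure (E \o mirror) B.
Proof.
move=> AB; have [Eproj E01 Eadd EAint] := EA.
have mmirror S : measurable S -> measurable (mirror S).
  by move=> mS; rewrite -[mirror S]setTI; exact: measurable_sub1.
split=> [S mS||F mF tF h|h].
- exact: Eproj (mmirror _ mS).
- by rewrite /= mirror_itv01.
- rewrite /= /mirror preimage_bigcup; apply: (Eadd (fun i => mirror (F i))) => //.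
    by move=> i; exact: mmirror.
  by move=> i j _ _ [t [Ft Gt]]; apply: tF => //; exists (1 - t).
- rewrite integral_mirror.
  have := integral_vector_state_compl h.
  rewrite -EAint.
  have <- : complex.Re '[A h, h] + complex.Re '[B h, h] = complex.Re '[h, h].
    have ABh : A h + B h = h by have /(congr1 (@^~ h)) := AB.
    transitivity (complex.Re '[A h + B h, h]); last by rewrite ABh.
    by rewrite linearDl -ReD.
  (* The integral of t is finite, so it can be cancelled in the extended reals. *)
  move=> AB_h; rewrite -[RHS](@addeK _ (complex.Re '[A h, h])%:E)//.
  by rewrite [X in (X - _)%E]addeC AB_h -EFinB addrAC subrr add0r.
Qed.
End SpectralMeasure.
End Spectral.

(** * Exchanging the two maps *)

Section Swap.
Variables (R : realType) (L H : hilbert R) (M : set (L -> L)) (N : set (H -> H)).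
Implicit Types (f g : R -> R) (Phi Psi : (L -> L) -> (H -> H)).

(** The Stinespring representation is kept; only the two densities trade places,
    together with their spectral measures. *)
Lemma is_max_divergence_swap f g Phi Psi m :
  (forall t : R, 0 <= t <= 1 -> perspective f t (1 - t) = perspective g (1 - t) t) ->
  is_max_divergence M N f Phi Psi m -> is_max_divergence M N g Psi Phi m.
Proof.
move=> fg [mN [K [p [V [A [B [E [[st Vb GE Vd] PhiA PsiB [AB EA] mE]]]]]]]].
split=> //; exists K, p, V, B, A, (E \o @mirror R); split=> //.
- split=> // x Mx; rewrite -GE//=; exact: addrC.
- split; first by rewrite addrC.
  exact: (spectral_measure_mirror EA AB).
- move=> w wH; rewrite mE// /conj_lb /op_perspective integral_mirror.
  apply: eq_integral_setfun => t; rewrite inE/= in_itv/= => t01.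
  by rewrite fg// subKr.
Qed.

(** Transposition is an involution on perspectives, so the exchange works in both
    directions, and the same choice is made from equal sets. *)
Lemma max_divergence_transpose f Phi Psi :
  max_divergence M N (transpose f) Phi Psi = max_divergence M N f Psi Phi.
Proof.
rewrite /max_divergence; congr (xget _ _); apply/seteqP.
by split=> m; apply: is_max_divergence_swap => t _; rewrite perspective_transpose.
Qed.
End Swap.

(** * Functions of positive definite matrices *)

Section MatrixFunctions.
Variable C : numClosedFieldType.
Local Open Scope sesquilinear_scope.
Implicit Types (g : C -> C) (m n : nat).

(** These notions are developed over an arbitrary closed field with conjugation,
    with scalar functions from the field to itself. Over R[i], the scalar function
    [complexify f] below gives back the notions for a real function f. *)
Definition spectral_fun g n (A : 'M[C]_n) : 'M[C]_n :=
  invmx (spectralmx A) *m diag_mx (map_mx g (spectral_diag A)) *m spectralmx A.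

Definition positive_definite n (A : 'M[C]_n) : Prop :=
  A \is hermsymmx /\ forall v : 'rV[C]_n, v != 0 -> 0 < dotmx (v *m A) v.

Definition le_loewner n (A B : 'M[C]_n) : Prop :=
  forall v : 'rV[C]_n, 0 <= dotmx (v *m (B - A)) v.

Definition matrix_convex g : Prop :=
  forall n (A B : 'M[C]_n) (l : C),
    positive_definite A -> positive_definite B -> 0 <= l <= 1 ->
    le_loewner (spectral_fun g (l *: A + (1 - l) *: B))
               (l *: spectral_fun g A + (1 - l) *: spectral_fun g B).

Lemma trmxC_mul m n p (A : 'M[C]_(m, n)) (B : 'M[C]_(n, p)) :
  (A *m B)^t* = B^t* *m A^t*.
Proof. by rewrite trmx_mul map_mxM. Qed.

Lemma trmxC_scale m n (a : C) (A : 'M[C]_(m, n)) : 0 <= a ->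
  (a *: A)^t* = a *: A^t*.
Proof.
by move=> a0; apply/matrixP => i j; rewrite !mxE rmorphM; congr (_ * _);
  exact: geC0_conj.
Qed.

Lemma trmxC_inv n (A : 'M[C]_n) : (invmx A)^t* = invmx (A^t*).
Proof. by rewrite trmx_inv map_invmx. Qed.

Lemma trmxC_diag n (d : 'rV[C]_n) : (forall i, 0 < d 0 i) ->
  (diag_mx d)^t* = diag_mx d.
Proof.
move=> d0; rewrite tr_diag_mx map_diag_mx; congr diag_mx.
by apply/rowP => j; rewrite !mxE; apply: geC0_conj; exact: ltW.
Qed.

Lemma hermsymmxP n (A : 'M[C]_n) : (A \is hermsymmx) <-> A^t* = A.
Proof.
split=> [/sesquiP|AA]; first by rewrite expr0 scale1r => {2}->.
by apply/sesquiP; rewrite expr0 scale1r AA.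
Qed.

Lemma dotmx_congr m n (X : 'M[C]_(m, n)) (A : 'M[C]_n) (v : 'rV[C]_m) :
  dotmx (v *m (X *m A *m X^t*)) v = dotmx (v *m X *m A) (v *m X).
Proof. by rewrite !dotmxE trmxC_mul !mulmxA. Qed.

Lemma le_loewner_congr m n (X : 'M[C]_(m, n)) (A B : 'M[C]_n) :
  le_loewner A B -> le_loewner (X *m A *m X^t*) (X *m B *m X^t*).
Proof.
by move=> AB v; rewrite -mulmxBl -mulmxBr dotmx_congr; exact: AB.
Qed.

Lemma posdef_congr m n (X : 'M[C]_(m, n)) (A : 'M[C]_n) :
  row_free X -> positive_definite A -> positive_definite (X *m A *m X^t*).
Proof.
move=> Xfree [/hermsymmxP hA pA]; split.
  by apply/hermsymmxP; rewrite !trmxC_mul trmxCK hA mulmxA.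
move=> v v0; rewrite dotmx_congr; apply: pA.
by apply: contraNneq v0 => vX; rewrite -(mulmx_free_eq0 _ Xfree) vX.
Qed.

Lemma posdef_convex n (A B : 'M[C]_n) (a b : C) : 0 <= a -> 0 <= b -> a + b = 1 ->
  positive_definite A -> positive_definite B ->
  positive_definite (a *: A + b *: B).
Proof.
move=> a0 b0 ab [/hermsymmxP hA pA] [/hermsymmxP hB pB]; split.
  apply/hermsymmxP; rewrite [in LHS]linearD/= map_mxD.
  by rewrite !trmxC_scale// hA hB.
move=> v v0; rewrite mulmxDr -!scalemxAr linearDl/= !linearZl_LR/=.
move: a0; rewrite le_eqVlt => /predU1P[a0|a0].
  by move: ab; rewrite -a0 add0r => ->; rewrite mul0r add0r mul1r pB.
by rewrite ltr_pwDl// ?mulr_gt0 ?pA// mulr_ge0// ltW// pB.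
Qed.

Lemma posdef1 n : positive_definite (1%:M : 'M[C]_n).
Proof.
split; first by apply/hermsymmxP; rewrite trmx1 map_mx1.
by move=> v v0; rewrite mulmx1 dotmx_is_dotmx.
Qed.

(** The diagonal entry d_i is the quadratic form of A at the i-th row of P, which
    is nonzero as P is unitary. *)
Lemma posdefP n (A : 'M[C]_n) : positive_definite A ->
  exists (P : 'M[C]_n) (d : 'rV[C]_n),
  [/\ P \is unitarymx, forall i, 0 < d 0 i & A = P^t* *m diag_mx d *m P].
Proof.
move=> [hA pA].
have /orthomx_spectralP := hermitian_normalmx hA.
have := spectral_unitarymx A.
move: (spectralmx A) (spectral_diag A) => P d Pu.
rewrite invmx_unitary// => AE.
exists P, d; split => // i.
have rowi0 : row i P != 0.
  apply/eqP => /(congr1 (mulmx^~ (P^t*))).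
  rewrite -row_mul (unitarymxP Pu) mul0mx => /rowP/(_ i)/eqP.
  by rewrite !mxE eqxx oner_eq0.
have := pA _ rowi0.
have -> : dotmx (row i P *m A) (row i P) = (P *m A *m P^t*) i i.
  by rewrite dotmxE -row_mul !mxE; apply: eq_bigr => k _; rewrite !mxE.
by rewrite AE !mulmxA (unitarymxP Pu) mul1mx mulmxtVK// !mxE eqxx mulr1n.
Qed.

(** Entrywise, d_i W_ij = W_ij e_j says that d_i = e_j wherever W_ij is nonzero,
    and this persists after applying [g]. *)
Lemma diag_mx_intertwine m n (d : 'rV[C]_m) (e : 'rV[C]_n) (W : 'M[C]_(m, n)) g :
  diag_mx d *m W = W *m diag_mx e ->
  diag_mx (map_mx g d) *m W = W *m diag_mx (map_mx g e).
Proof.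
move=> dW; apply/matrixP => i j.
move/matrixP/(_ i j): dW; rewrite !mul_diag_mx !mul_mx_diag !mxE.
have [->|W0] := eqVneq (W i j) 0; first by rewrite !(mulr0, mul0r).
by rewrite mulrC => /(mulfI W0) ->; rewrite mulrC.
Qed.

(** The matrix function does not depend on the diagonalization: two of them are
    intertwined by the unitary Q P^*, hence so are the transformed diagonals. *)
Lemma spectral_fun_unitary g n (P : 'M[C]_n) (d : 'rV[C]_n) : P \is unitarymx ->
  spectral_fun g (P^t* *m diag_mx d *m P) = P^t* *m diag_mx (map_mx g d) *m P.
Proof.
move=> Pu; set A := P^t* *m _ *m _.
have An : A \is normalmx.
  apply/normalmxP; rewrite /A !trmxC_mul trmxCK !mulmxA.
  rewrite !(mulmxtVK _ Pu); congr (_ *m P); rewrite -!mulmxA; congr (_ *m _).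
  by rewrite tr_diag_mx map_diag_mx diag_mxC.
have /orthomx_spectralP := An.
have Qu := spectral_unitarymx A.
rewrite /spectral_fun.
move: (spectralmx A) (spectral_diag A) Qu => Q e Qu.
rewrite invmx_unitary// => AE.
have QP : diag_mx e *m (Q *m P^t*) = (Q *m P^t*) *m diag_mx d.
  transitivity (Q *m A *m P^t*).
    by rewrite AE !mulmxA (unitarymxP Qu) mul1mx.
  by rewrite /A !mulmxA mulmxtVK.
have := diag_mx_intertwine g QP.
move=> /(congr1 (fun W => Q^t* *m W *m P)).
by rewrite !mulmxA (mulmx1C (unitarymxP Qu)) mul1mx mulmxKtV.
Qed.

(** All matrices involved are diagonal in one basis, so the last clause reduces to
    the scalar identity z^(1/2) g(1/z) z^(1/2) = z g(1/z). *)
Lemma posdef_sqrt n (A : 'M[C]_n) : positive_definite A -> exists S : 'M[C]_n,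
  [/\ S \in unitmx, S^t* = S, S *m S = A &
      forall g g', (forall z, 0 < z -> g' z = z * g z^-1) ->
        S *m spectral_fun g (invmx A) *m S = spectral_fun g' A].
Proof.
move=> /posdefP[P [d [Pu d0 AE]]].
pose D (e : 'rV[C]_n) := P^t* *m diag_mx e *m P.
have DM (e e' : 'rV[C]_n) : D e *m D e' = D (\row_j (e 0 j * e' 0 j)).
  rewrite /D !mulmxA (mulmxtVK _ Pu); congr (_ *m P); rewrite -!mulmxA.
  by congr (_ *m _); apply/matrixP => i j; rewrite mul_diag_mx !mxE mulrnAr.
have Dfun g e : spectral_fun g (D e) = D (map_mx g e).
  by rewrite /D spectral_fun_unitary.
have D1 : D (const_mx 1) = 1%:M.
  by rewrite /D diag_const_mx mulmx1 (mulmx1C (unitarymxP Pu)).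
have dV : D d *m D (map_mx GRing.inv d) = 1%:M.
  by rewrite DM -D1; congr D; apply/rowP => j; rewrite !mxE divff// gt_eqF.
have AV : invmx A = D (map_mx GRing.inv d).
  have [Aunit _] := mulmx1_unit dV.
  by rewrite AE -[LHS]mulmx1 -dV mulKmx.
have ss : D (map_mx sqrtC d) *m D (map_mx sqrtC d) = A.
  by rewrite AE DM; congr D; apply/rowP => j; rewrite !mxE -expr2 sqrtCK.
exists (D (map_mx sqrtC d)); split => //.
- have [Au _] := mulmx1_unit dV; move: Au; rewrite -[D d]AE -ss.
  by rewrite unitmx_mul => /andP[].
- rewrite /D !trmxC_mul trmxCK trmxC_diag ?mulmxA// => i.
  by rewrite mxE sqrtC_gt0.
- move=> g g' gg'; rewrite AV Dfun !DM AE -/(D d) Dfun.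
  by congr D; apply/rowP => j; rewrite !mxE gg'// mulrAC -expr2 sqrtCK.
Qed.

Lemma spectral_fun_unitary_congr g n (U A : 'M[C]_n) :
  U \is unitarymx -> positive_definite A ->
  spectral_fun g (U *m A *m U^t*) = U *m spectral_fun g A *m U^t*.
Proof.
move=> Uu /posdefP[P [d [Pu d0 ->]]].
have UPu : P *m U^t* \is unitarymx by rewrite mul_unitarymx// trmxC_unitary.
have conjE (e : 'rV[C]_n) : U *m (P^t* *m diag_mx e *m P) *m U^t* =
    (P *m U^t*)^t* *m diag_mx e *m (P *m U^t*).
  by rewrite trmxC_mul trmxCK !mulmxA.
by rewrite spectral_fun_unitary// !conjE spectral_fun_unitary.
Qed.

Lemma spectral_fun_block_diag g m n (A : 'M[C]_m) (B : 'M[C]_n) :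
  positive_definite A -> positive_definite B ->
  spectral_fun g (block_mx A 0 0 B) =
  block_mx (spectral_fun g A) 0 0 (spectral_fun g B).
Proof.
move=> /posdefP[P [d [Pu d0 ->]]] /posdefP[Q [e [Qu e0 ->]]].
rewrite !spectral_fun_unitary//.
have blockE (x : 'rV[C]_m) (y : 'rV[C]_n) :
    block_mx (P^t* *m diag_mx x *m P) 0 0 (Q^t* *m diag_mx y *m Q) =
    (block_mx P 0 0 Q)^t* *m diag_mx (row_mx x y) *m block_mx P 0 0 Q.
  rewrite diag_mx_row tr_block_mx map_block_mx !trmx0 !map_mx0 !mulmx_block.
  by rewrite !(mul0mx, mulmx0, addr0, add0r).
rewrite !blockE spectral_fun_unitary ?map_row_mx//.
apply/unitarymxP; rewrite tr_block_mx map_block_mx !trmx0 !map_mx0 mulmx_block.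
rewrite !(mul0mx, mulmx0, addr0, add0r) !(unitarymxP Pu, unitarymxP Qu).
by rewrite -scalar_mx_block.
Qed.
End MatrixFunctions.

(** * Compression and Jensen's inequality *)

Section Compression.
Variable C : numClosedFieldType.
Local Open Scope sesquilinear_scope.
Implicit Types (g : C -> C) (m n : nat).

(** Corners are compressions by the coordinate isometries, so they inherit
    positivity and the Loewner order. *)
Lemma ulsubmx_congr m n (X : 'M[C]_(m + n)) (E := row_mx 1%:M 0 : 'M[C]_(m, m + n)) :
  E *m X *m E^t* = ulsubmx X.
Proof.
rewrite /E -{1}[X]submxK tr_row_mx map_col_mx mul_row_block mul_row_col.
by rewrite trmx1 trmx0 map_mx1 map_mx0 !(mul1mx, mul0mx, mulmx1, mulmx0, addr0).
Qed.

Lemma drsubmx_congr m n (X : 'M[C]_(m + n)) (E := row_mx 0 1%:M : 'M[C]_(n, m + n)) :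
  E *m X *m E^t* = drsubmx X.
Proof.
rewrite /E -{1}[X]submxK tr_row_mx map_col_mx mul_row_block mul_row_col.
by rewrite trmx1 trmx0 map_mx1 map_mx0 !(mul1mx, mul0mx, mulmx1, mulmx0, add0r).
Qed.

Lemma posdef_ulsubmx m n (X : 'M[C]_(m + n)) :
  positive_definite X -> positive_definite (ulsubmx X).
Proof.
rewrite -ulsubmx_congr; apply: posdef_congr; apply/row_freeP.
by exists (col_mx 1%:M 0); rewrite mul_row_col mulmx1 mulmx0 addr0.
Qed.

Lemma posdef_drsubmx m n (X : 'M[C]_(m + n)) :
  positive_definite X -> positive_definite (drsubmx X).
Proof.
rewrite -drsubmx_congr; apply: posdef_congr; apply/row_freeP.
by exists (col_mx 0 1%:M); rewrite mul_row_col mulmx1 mulmx0 add0r.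
Qed.

Lemma posdef_block_diag m n (A : 'M[C]_m) (B : 'M[C]_n) :
  positive_definite A -> positive_definite B ->
  positive_definite (block_mx A 0 0 B).
Proof.
move=> [/hermsymmxP hA pA] [/hermsymmxP hB pB]; split.
  by apply/hermsymmxP; rewrite tr_block_mx map_block_mx !trmx0 !map_mx0 hA hB.
move=> v; rewrite -[v]hsubmxK; move: (lsubmx v) (rsubmx v) => x y xy0.
have -> : dotmx (row_mx x y *m block_mx A 0 0 B) (row_mx x y) =
    dotmx (x *m A) x + dotmx (y *m B) y.
  rewrite !dotmxE tr_row_mx map_col_mx mul_row_block !mulmx0 addr0 add0r.
  by rewrite mul_row_col mxE.
have [x0|x0] := eqVneq x 0.
  have y0 : y != 0 by apply: contraNneq xy0 => ->; rewrite x0 row_mx0.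
  by rewrite x0 mul0mx dotmxE mul0mx mxE add0r pB.
rewrite ltr_pwDl ?pA//; have [->|y0] := eqVneq y 0; last by rewrite ltW// pB.
by rewrite mul0mx dotmxE mul0mx mxE.
Qed.

(** Conjugation by J = diag(1, -1) flips the sign of the off-diagonal blocks, so
    the mean of X and J X J^* is block diagonal with the same corners as X.
    Convexity at this mean, read in the upper left corner, is the claim, because
    the function commutes with unitary conjugation and with block diagonals. *)
Lemma spectral_fun_compression g m n (X : 'M[C]_(m + n)) :
  matrix_convex g -> positive_definite X ->
  le_loewner (spectral_fun g (ulsubmx X)) (ulsubmx (spectral_fun g X)).
Proof.
move=> gconv Xpos.
pose J : 'M[C]_(m + n) := block_mx 1%:M 0 0 (- 1%:M).
have Jadj : J^t* = J.
  rewrite /J tr_block_mx map_block_mx !trmx0 !map_mx0 trmx1 map_mx1.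
  by rewrite linearN/= map_mxN trmx1 map_mx1.
have Ju : J \is unitarymx.
  apply/unitarymxP; rewrite Jadj mulmx_block.
  rewrite !(mul1mx, mul0mx, mulmx1, mulmx0, add0r, addr0) mulNmx mul1mx opprK.
  by rewrite -scalar_mx_block.
have JXJ (Y : 'M[C]_(m + n)) : J *m Y *m J^t* =
    block_mx (ulsubmx Y) (- ursubmx Y) (- dlsubmx Y) (drsubmx Y).
  rewrite Jadj -{1}[Y]submxK !mulmx_block.
  rewrite !(mul1mx, mul0mx, mulmx1, mulmx0, add0r, addr0).
  by rewrite !mulmxN !mulNmx !mul1mx !mulmx1 opprK.
have half_half : 1 - 2^-1 = 2^-1 :> C by field.
have mean (Y : 'M[C]_(m + n)) :
    2^-1 *: Y + (1 - 2^-1) *: (J *m Y *m J^t*) =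
    block_mx (ulsubmx Y) 0 0 (drsubmx Y).
  have half (p q : nat) (Z : 'M[C]_(p, q)) : 2^-1 *: Z + 2^-1 *: Z = Z.
    by rewrite -scalerDl -{1}half_half subrK scale1r.
  rewrite JXJ -{1}[Y]submxK half_half !scale_block_mx add_block_mx !half.
  by rewrite !scalerN !subrr.
have Xul := posdef_ulsubmx Xpos; have Xdr := posdef_drsubmx Xpos.
have JXpos : positive_definite (J *m X *m J^t*).
  by apply: posdef_congr => //; rewrite row_free_unit unitarymx_unit.
have h01 : 0 <= (2^-1 : C) <= 1.
  by rewrite invr_ge0 ler0n invf_le1 ?ler1n ?ltr0n.
have := gconv _ _ _ _ Xpos JXpos h01.
rewrite spectral_fun_unitary_congr// !mean spectral_fun_block_diag//.
move=> /(le_loewner_congr (row_mx 1%:M 0 : 'M[C]_(m, m + n))).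
by rewrite !ulsubmx_congr !block_mxKul.
Qed.

Lemma invmx_sqr n (S : 'M[C]_n) : S \in unitmx ->
  invmx (S *m S) = invmx S *m invmx S.
Proof.
move=> Su; have SSu : S *m S \in unitmx by rewrite unitmx_mul Su.
rewrite -[RHS]mul1mx -(mulVmx SSu) -!mulmxA.
by rewrite mulKVmx// mulmxV// mulmx1.
Qed.

Lemma posdef_inv n (A : 'M[C]_n) :
  positive_definite A -> positive_definite (invmx A).
Proof.
move=> /posdef_sqrt[S [Su Sadj <- _]].
have -> : invmx (S *m S) = invmx S *m 1%:M *m (invmx S)^t*.
  by rewrite mulmx1 trmxC_inv Sadj invmx_sqr.
by apply: posdef_congr (posdef1 _ _); rewrite row_free_unit unitmx_inv.
Qed.

(** Jensen's inequality for the pair (C_1, C_2) = (l^(1/2) T^(-1/2) A^(1/2),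
    (1 - l)^(1/2) T^(-1/2) B^(1/2)), obtained by compressing the block-diagonal
    matrix diag(A^-1, B^-1) after conjugation by a unitary with first block row
    (C_1, C_2), then conjugated by T^(1/2). *)
Lemma matrix_convex_transpose g g' :
  (forall z, 0 < z -> g' z = z * g z^-1) -> matrix_convex g -> matrix_convex g'.
Proof.
move=> gg' gconv n A B l Apos Bpos /andP[l0 l1].
have l1' : 0 <= 1 - l by rewrite subr_ge0.
set T := _ + _.
have Tpos : positive_definite T by apply: posdef_convex => //; rewrite addrC subrK.
have AVpos := posdef_inv Apos; have BVpos := posdef_inv Bpos.
(* The second block row of the unitary is W^(-1/2) times
   ((1 - l)^(1/2) A^(-1/2), - l^(1/2) B^(-1/2)). This row is orthogonal to the first
   since the powers of A, and those of B, cancel; the factor W^(-1/2) normalizes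
   it. *)
pose W := (1 - l) *: invmx A + l *: invmx B.
have Wpos : positive_definite W by apply: posdef_convex => //; rewrite subrK.
have [SA [SAu SAadj SA2 gA]] := posdef_sqrt Apos.
have [SB [SBu SBadj SB2 gB]] := posdef_sqrt Bpos.
have [ST [STu STadj ST2 gT]] := posdef_sqrt Tpos.
have [SW [SWu SWadj SW2 _]] := posdef_sqrt Wpos.
pose a := sqrtC l; pose b := sqrtC (1 - l).
have a0 : 0 <= a by rewrite sqrtC_ge0.
have b0 : 0 <= b by rewrite sqrtC_ge0.
have aa : a * a = l by rewrite -expr2 sqrtCK.
have bb : b * b = 1 - l by rewrite -expr2 sqrtCK.
pose U : 'M[C]_(n + n) := block_mx
  (a *: (invmx ST *m SA)) (b *: (invmx ST *m SB))
  (b *: (invmx SW *m invmx SA)) (- (a *: (invmx SW *m invmx SB))).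
have Uadj : U^t* = block_mx
    (a *: (SA *m invmx ST)) (b *: (invmx SA *m invmx SW))
    (b *: (SB *m invmx ST)) (- (a *: (invmx SB *m invmx SW))).
  have trN (Y : 'M[C]_n) : (- Y)^t* = - Y^t* by rewrite linearN/= map_mxN.
  rewrite /U tr_block_mx map_block_mx trN.
  by rewrite !trmxC_scale// !trmxC_mul !trmxC_inv SAadj SBadj STadj SWadj.
have Uconj Y Z : ulsubmx (U *m block_mx Y 0 0 Z *m U^t*) =
    invmx ST *m (l *: (SA *m Y *m SA) + (1 - l) *: (SB *m Z *m SB)) *m invmx ST.
  rewrite Uadj /U !mulmx_block block_mxKul !mulmx0 addr0 add0r.
  rewrite -!scalemxAl -!scalemxAr !scalerA aa bb.
  by rewrite mulmxDr mulmxDl -!scalemxAr -!scalemxAl !mulmxA.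
have sqrt_inv (S Y : 'M[C]_n) : S \in unitmx -> S *m S = Y ->
    invmx S *m Y *m invmx S = 1%:M.
  by move=> Su <-; rewrite mulKmx// mulmxV.
have inv_sqrt (S Y : 'M[C]_n) : S \in unitmx -> S *m S = Y ->
    S *m invmx Y *m S = 1%:M.
  by move=> Su <-; rewrite invmx_sqr// mulmxA mulmxV// mul1mx mulVmx.
have Uu : U \is unitarymx.
  have Uul : ulsubmx (U *m U^t*) = 1%:M.
    have := Uconj 1%:M 1%:M; rewrite -scalar_mx_block !mulmx1 => ->.
    by rewrite SA2 SB2 sqrt_inv.
  apply/unitarymxP; rewrite -[LHS]submxK Uul Uadj /U !mulmx_block.
  rewrite block_mxKur block_mxKdl block_mxKdr scalar_mx_block.
  rewrite !(mulmxN, mulNmx) !opprK -!scalemxAl -!scalemxAr !scalerA aa bb.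
  rewrite !mulmxA !mulmxKV// !mulmxK// [b * a]mulrC !subrr; congr block_mx.
  rewrite -!(mulmxA (invmx SW)) -!mulmxA.
  by rewrite -(sqrt_inv _ _ SWu SW2) /W -SA2 -SB2 !invmx_sqr// mulmxDr mulmxDl
    -!scalemxAr -!scalemxAl !mulmxA.
have Xpos := posdef_block_diag AVpos BVpos.
have UXpos : positive_definite (U *m block_mx (invmx A) 0 0 (invmx B) *m U^t*).
  by apply: posdef_congr => //; rewrite row_free_unit unitarymx_unit.
(* Both corners are given by [Uconj]; on the left the argument of the function
   collapses to T^(-1/2) (l + (1 - l)) T^(-1/2) = T^-1. *)
have := spectral_fun_compression gconv UXpos.
rewrite spectral_fun_unitary_congr// spectral_fun_block_diag// !Uconj.
rewrite !inv_sqrt// !(gA _ _ gg') !(gB _ _ gg') -scalerDl addrC subrK scale1r.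
rewrite mulmx1 -invmx_sqr// ST2 => /(le_loewner_congr ST).
by rewrite STadj (gT _ _ gg') !mulmxA mulmxV// mul1mx mulmxKV.
Qed.
End Compression.

(** * Operator convexity of the transpose *)

Section OperatorConvexTranspose.
Variable R : realType.
Implicit Types f : R -> R.

Definition complexify f : R[i] -> R[i] := fun z => ((f (complex.Re z))%:C)%C.

Lemma complex_1B (l : R) : ((1 - l)%:C = 1 - l%:C)%C.
Proof. by rewrite rmorphB rmorph1. Qed.

Lemma complex_itv01 (l : R) : (0 <= (l%:C)%C <= 1) = (0 <= l <= 1).
Proof. by rewrite ler0c -(rmorph1 (real_complex R)) lecR. Qed.

(** In R[i] the condition 0 <= l <= 1 forces l to be real, so both sides quantify
    over the same convex combinations. *)
Lemma operator_convexP f : operator_convex f <-> matrix_convex (complexify f).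
Proof.
split=> fconv n A B l Apos Bpos l01.
- have lE : l = ((complex.Re l)%:C)%C.
    by rewrite RRe_real// ger0_real//; case/andP: l01.
  move: l01; rewrite lE complex_itv01 => l01.
  have := fconv n A B (complex.Re l) Apos Bpos l01.
  by rewrite complex_1B.
- rewrite complex_1B.
  have := fconv n A B (l%:C)%C Apos Bpos.
  by rewrite complex_itv01 => /(_ l01).
Qed.

Lemma operator_convex_transpose f :
  operator_convex f -> operator_convex (transpose f).
Proof.
move=> /operator_convexP fconv; apply/operator_convexP.
apply: matrix_convex_transpose fconv => z z0.
have zE : z = ((complex.Re z)%:C)%C by rewrite RRe_real// gtr0_real.
by rewrite zE -fmorphV /complexify /= rmorphM.
Qed.
End OperatorConvexTranspose.

Theorem proposition4p2 (R : realType) (L H : hilbert R)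
    (M : set (L -> L)) (N : set (H -> H)) (f : R -> R)
    (Phi Psi : (L -> L) -> (H -> H)) :
  von_neumann_algebra M -> von_neumann_algebra N ->
  operator_convex f ->
  completely_positive M N Phi -> completely_positive M N Psi ->
  operator_convex (transpose f) /\
  max_divergence M N (transpose f) Phi Psi = max_divergence M N f Psi Phi.
Proof.
move=> _ _ fconv _ _; split; first exact: operator_convex_transpose.
exact: max_divergence_transpose.
Qed.
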